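(* Let $f,h:\mathbb{N}\to\mathbb{Q}$ be bijections. Then the canonical bases $(e_{f,n})_n$ of $X_f$ and $(e_{h,n})_n$ of $X_h$ are permutatively equivalent. In particular, all Sierpiński spaces are isomorphic to one another.
   Context: For a bijection $f:\mathbb{N}\to\mathbb{Q}$, let $\mathcal{C}_f$ be the family of all finite sets $F\subseteq\mathbb{N}$ on which $f$ is increasing (i.e. $n<k$ in $F$ implies $f(n)<f(k)$). For $x\in\mathbb{R}^{\mathbb{N}}$ let $\|x\|_f=\sup\{\sum_{i\in F}|x(i)|:F\in\mathcal{C}_f\}$. The Sierpiński space $X_f=\{x\in\mathbb{R}^{\mathbb{N}}:\|x\cdot\chi_{[n,\infty)}\|_f\to0\}$ is a Banach space under $\|\cdot\|_f$, with basis the unit vectors $(e_{f,n})_n$. Bases $(a_n)$, $(b_n)$ are permutatively equivalent if there are a permutation $\rho$ of $\mathbb{N}$ and a constant $C\ge1$ with $C^{-1}\|\sum_nc_nb_{\rho(n)}\|\le\|\sum_nc_na_n\|\le C\|\sum_nc_nb_{\rho(n)}\|$ for all finitely supported real sequences $(c_n)$. Isomorphic means linearly homeomorphic. *)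

(* Defs.v *)
From HB Require Import structures.
From mathcomp Require Import all_boot all_order all_algebra finmap.
From mathcomp Require Import all_classical all_reals all_analysis.

Set Implicit Arguments.
Unset Strict Implicit.
Unset Printing Implicit Defensive.

Import Order.TTheory GRing.Theory Num.Theory.
Import numFieldNormedType.Exports.

Local Open Scope classical_set_scope.
Local Open Scope ring_scope.

Definition increasing_fsets (f : nat -> rat) : set {fset nat} :=
  [set F | forall n k, n \in F -> k \in F -> (n < k)%N -> f n < f k].

(* Defined on every sequence, hence possibly +oo. *)
Definition sier_norm (R : realType) (f : nat -> rat) (x : nat -> R) : \bar R :=
  ereal_sup [set (\sum_(i <- F) `|x i|)%:E | F in increasing_fsets f].

Definition in_sier (R : realType) (f : nat -> rat) : {pred nat -> R} :=
  fun x => `[< sier_norm f (x \* \1_[set k | (n <= k)%N]) @[n --> \oo]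
               --> 0%E >].

Section SierNorm.
Context (R : realType) (f : nat -> rat).
Implicit Types (x y : nat -> R) (n : nat).
Local Notation N := (@sier_norm R f).
Local Notation tail x n := (x \* \1_[set k | (n <= k)%N]).

Lemma sier_norm_ub x F : increasing_fsets f F ->
  ((\sum_(i <- F) `|x i|)%:E <= N x)%E.
Proof. by move=> CF; apply: ereal_sup_ubound; exists F. Qed.

Lemma sier_norm_le x (a : \bar R) :
  (forall F, increasing_fsets f F -> ((\sum_(i <- F) `|x i|)%:E <= a)%E) ->
  (N x <= a)%E.
Proof. by move=> H; apply: ge_ereal_sup => _ [F /H ? <-]. Qed.

Lemma sier_norm_ge0 x : (0 <= N x)%E.
Proof.
have /(sier_norm_ub x) : increasing_fsets f fset0 by move=> n k; rewrite inE.
by rewrite big_seq_fset0.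
Qed.

Lemma increasing_fset1 n : increasing_fsets f [fset n]%fset.
Proof. by move=> i k; rewrite !inE => /eqP-> /eqP->; rewrite ltnn. Qed.

Lemma sier_norm_coord x n : (`|x n|%:E <= N x)%E.
Proof. by have /(sier_norm_ub x) := @increasing_fset1 n; rewrite big_seq_fset1. Qed.

Lemma sier_normD x y : (N (x + y)%R <= N x + N y)%E.
Proof.
apply: sier_norm_le => F CF.
apply: (le_trans _ (leeD (sier_norm_ub x CF) (sier_norm_ub y CF))).
by rewrite -EFinD lee_fin -big_split/=; apply: ler_sum => i _; exact: ler_normD.
Qed.

Lemma sier_normZ_le (l : R) x : (N (l *: x)%R <= `|l|%:E * N x)%E.
Proof.
apply: sier_norm_le => F CF.
under eq_bigr do rewrite [(l *: x) _]/GRing.scale/= normrM.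
rewrite -mulr_sumr EFinM; apply: lee_wpmul2l; first by rewrite lee_fin.
exact: sier_norm_ub.
Qed.

Lemma sier_normZ (l : R) x : N (l *: x)%R = (`|l|%:E * N x)%E.
Proof.
apply/eqP; rewrite eq_le sier_normZ_le/=.
have [->|l0] := eqVneq l 0; first by rewrite normr0 mul0e sier_norm_ge0.
have := sier_normZ_le l^-1 (l *: x).
rewrite scalerA mulVf// scale1r => /(lee_wpmul2l (x := `|l|%:E)).
by rewrite lee_fin muleA -EFinM -normrM divff// normr1 mul1e; apply.
Qed.

Lemma sier_norm0 : N 0%R = 0%E.
Proof. by rewrite -(scale0r 0) sier_normZ normr0 mul0e. Qed.

Lemma sier_norm_unit n : (N (\1_[set n]) <= 1)%E.
Proof.
apply: sier_norm_le => F CF; rewrite lee_fin.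
under eq_bigr do rewrite indicE classical_sets.in_set1 ger0_norm//.
have [nF|nF] := boolP (n \in F).
  rewrite (big_fsetD1 n)//= eqxx big_seq big1 ?addr0// => i.
  by rewrite !inE => /andP[/negbTE->].
rewrite big_seq big1// => i iF.
by have [e|] := eqVneq i n => //; rewrite -e iF in nF.
Qed.

Lemma sier_tailD x y n : tail (x + y) n = tail x n + tail y n.
Proof. by apply/funext => k; exact: mulrDl. Qed.

Lemma sier_tailZ l x n : tail (l *: x) n = l *: tail x n.
Proof. by apply/funext => k; exact/esym/mulrA. Qed.

Lemma sier_tail0 x : tail x 0%N = x.
Proof. by apply/funext => k; rewrite /= indicE mem_set//= mulr1. Qed.

Lemma sier_tailS x n : tail x n = tail x n.+1 + x n *: (\1_[set n] : nat -> R).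
Proof.
apply/funext => k.
have tE i : (x \* \1_[set k | (i <= k)%N]) k = x k * (i <= k)%N%:R.
  by rewrite /= indicE; congr (_ * (nat_of_bool _)%:R); apply/idP/idP => [/set_mem|/mem_set].
transitivity (x k * (n < k)%N%:R + x n * (k == n)%:R); last first.
  by rewrite -tE -classical_sets.in_set1.
rewrite tE; have [->|nk] := eqVneq k n.
  by rewrite leqnn ltnn mulr0 add0r.
by rewrite mulr0 addr0 ltn_neqAle eq_sym nk.
Qed.

Lemma sier_norm_tail_lty x n : (N (tail x n) < +oo)%E -> (N x < +oo)%E.
Proof.
elim: n => [|n IHn]; first by rewrite sier_tail0.
move=> h; apply: IHn; rewrite sier_tailS (le_lt_trans (sier_normD _ _))//.
rewrite lte_add_pinfty// sier_normZ.
rewrite (@le_lt_trans _ _ (`|x n|%:E * 1)%E) ?mule1 ?ltry//.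
by rewrite -[leRHS]mule1 lee_wpmul2l ?lee_fin// sier_norm_unit.
Qed.

Lemma in_sierP x : reflect (N (tail x n) @[n --> \oo] --> 0%E) (x \in in_sier f).
Proof. exact: asboolP. Qed.

Lemma sier_norm_fin_num x : x \in in_sier f -> N x \is a fin_num.
Proof.
move=> /in_sierP/fine_cvgP[[n _ Hn] _].
rewrite ge0_fin_numE ?sier_norm_ge0//; apply: (@sier_norm_tail_lty _ n).
by have := Hn n (leqnn n); rewrite ge0_fin_numE// sier_norm_ge0.
Qed.

Lemma in_sier_submod : submod_closed (@in_sier R f).
Proof.
split=> [|l x y xf yf]; apply/in_sierP.
  rewrite (_ : (fun _ => _) = cst 0%E); first exact: cvg_cst.
  apply/funext => n; rewrite -[RHS]sier_norm0; congr N.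
  by apply/funext => k; exact: mul0r.
have /in_sierP xf0 := xf; have /in_sierP yf0 := yf.
apply: (@squeeze_cvge _ _ _ _ (cst 0%E) _
  (fun n => `|l|%:E * N (tail x n) + N (tail y n))%E).
- apply: nearW => n; rewrite sier_norm_ge0/= sier_tailD sier_tailZ.
  by rewrite (le_trans (sier_normD _ _))// sier_normZ.
- exact: cvg_cst.
rewrite (_ : 0%E = `|l|%:E * 0 + 0)%E; last by rewrite mule0 adde0.
by apply: cvgeD => //; exact: cvgeZl.
Qed.

Lemma in_sier_unit n : (\1_[set n] : nat -> R) \in in_sier f.
Proof.
apply/in_sierP; apply: cvg_near_cst; exists n.+1 => // m /= nm.
rewrite -[RHS]sier_norm0; congr N; apply/funext => k /=.
rewrite !indicE classical_sets.in_set1; have [->|_] := eqVneq k n; last by rewrite mul0r.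
by rewrite memNset ?mulr0//= leqNgt nm.
Qed.

HB.instance Definition _ := GRing.isSubmodClosed.Build R (nat -> R) (@in_sier R f)
  in_sier_submod.

End SierNorm.

Record sierpinski (R : realType) (f : nat -> rat) := Sierpinski {
  sier_val :> nat -> R;
  sier_valP : sier_val \in in_sier f }.

Section SierpinskiSpace.
Context (R : realType) (f : nat -> rat).
Local Notation X := (sierpinski R f).

HB.instance Definition _ := [isSub for @sier_val R f].
HB.instance Definition _ := [Choice of X by <:].
HB.instance Definition _ := [SubChoice_isSubLmodule of X by <:].

Lemma sierpinski_normD (x y : X) :
  fine (sier_norm f (x + y : X)) <= fine (sier_norm f x) + fine (sier_norm f y).
Proof.
rewrite -fineD ?sier_norm_fin_num ?sier_valP// fine_le ?sier_normD//.
  by rewrite sier_norm_fin_num ?sier_valP.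
by rewrite fin_numD !sier_norm_fin_num ?sier_valP.
Qed.

Lemma sierpinski_normZ (l : R) (x : X) :
  fine (sier_norm f (l *: x : X)) = `|l| * fine (sier_norm f x).
Proof. by rewrite sier_normZ fineM ?sier_norm_fin_num ?sier_valP. Qed.

Lemma sierpinski_norm_eq0 (x : X) : fine (sier_norm f x) = 0 -> x = 0.
Proof.
move=> x0; apply: val_inj; apply/funext => n; apply/eqP.
rewrite -normr_le0 -lee_fin (le_trans (sier_norm_coord f _ n))//.
by rewrite -(fineK (sier_norm_fin_num (sier_valP x))) x0.
Qed.

HB.instance Definition _ := Lmodule_isNormed.Build R X
  sierpinski_normD sierpinski_normZ sierpinski_norm_eq0.

Definition sier_basis (n : nat) : X := Sierpinski (in_sier_unit R f n).

Lemma sierpinski_normE (x : X) : `|x| = fine (sier_norm f x).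
Proof. by []. Qed.

End SierpinskiSpace.

Definition permutatively_equivalent (R : realType) (V W : normedModType R)
    (a : nat -> V) (b : nat -> W) : Prop :=
  exists (rho : nat -> nat) (C : R), [/\ bijective rho, 1 <= C &
    forall c : nat -> R, finite_set [set n | c n != 0] ->
      C^-1 * `|\sum_(n \in [set n | c n != 0]) c n *: b (rho n)|
        <= `|\sum_(n \in [set n | c n != 0]) c n *: a n|
        <= C * `|\sum_(n \in [set n | c n != 0]) c n *: b (rho n)| ].

Definition linearly_homeomorphic (R : realType) (V W : normedModType R) : Prop :=
  exists (T : {linear V -> W}) (S : W -> V),
    [/\ cancel T S, cancel S T, continuous T & continuous S].

(* Main.v *)
(** Since [h] hits every open interval at arbitrarily late indices, one can
    choose recursively a strictly increasing [phi : nat -> nat] such that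
    [h \o phi] is ordered exactly like [f]; then a finite set is increasing for
    [f] iff its image under [phi] is increasing for [h].  Take such a [psi] from
    [h] to [f] as well.  The Cantor-Bernstein construction turns [phi] and [psi]
    into a permutation [rho] agreeing at each point with [phi] or with the
    inverse of [psi], so [rho] and its inverse map every increasing set to a
    union of two increasing sets and the two norms are equivalent with constant
    2. *)
Require Import Defs.
From HB Require Import structures.
From mathcomp Require Import all_boot all_order all_algebra finmap.
From mathcomp Require Import all_classical all_reals all_analysis.

Set Implicit Arguments.
Unset Strict Implicit.
Unset Printing Implicit Defensive.

Import Order.TTheory GRing.Theory Num.Theory.
Import numFieldNormedType.Exports.

Local Open Scope classical_set_scope.
Local Open Scope ring_scope.

(** * Separation of finite lists in an ordered field *)

Lemma seq_between (K : realFieldType) (L U : seq K) :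
  {in L & U, forall l u, l < u} ->
  exists2 q, {in L, forall l, l < q} & {in U, forall u, q < u}.
Proof.
move=> LU.
have lower (V : seq K) (l : K) : {in V, forall u, l < u} ->
    exists2 q, l < q & {in V, forall u, q < u}.
  elim: V => [|v V IH] lV; first by exists (l + 1); rewrite ?ltrDl.
  have [u uV|q lq qV] := IH; first by apply: lV; rewrite inE uV orbT.
  have lv : l < v by apply: lV; rewrite mem_head.
  exists (Num.min q ((l + v) / 2)); first by rewrite lt_min lq midf_lt.
  move=> u; rewrite inE => /predU1P[->|/qV qu].
    by rewrite gt_min (midf_lt lv) orbT.
  by rewrite gt_min qu.
elim: L LU => [|l L IH] LU.
  suff [q qU] : exists q, {in U, forall u, q < u} by exists q.
  elim: U {LU} => [|u U [q qU]]; first by exists 0.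
  exists (Num.min q (u - 1)) => v; rewrite inE gt_min => /predU1P[->|/qU->//].
  by rewrite gtrDl oppr_lt0 ltr01 orbT.
have [l' u l'L uU|q Lq qU] := IH; first by apply: LU; rewrite // inE l'L orbT.
(* If [q] does not exceed the new bound [l], a point just above [l] replaces it; the older lower
   bounds are below [q <= l], hence below that point too. *)
have [lq|ql] := ltP l q.
  by exists q => // l'; rewrite inE => /predU1P[->|/Lq].
have [u uU|q' lq' q'U] := lower U l; first by apply: LU; rewrite // mem_head.
exists q' => // l'; rewrite inE => /predU1P[->//|/Lq l'q].
exact: lt_trans (lt_le_trans l'q ql) lq'.
Qed.

(** A forbidden point [a] below all of [U] becomes one more lower bound; otherwise some [u] in [U]
    has [u <= a], and [q < u] already excludes [a]. *)
Lemma seq_between_notin (K : realFieldType) (A L U : seq K) :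
  {in L & U, forall l u, l < u} ->
  exists q, [/\ {in L, forall l, l < q}, {in U, forall u, q < u} & q \notin A].
Proof.
elim: A L => [|a A IH] L LU.
  by have [q Lq qU] := seq_between LU; exists q.
have [/allP aU|/allPn[u uU]] := boolP (all (> a) U).
  have [|q [Lq qU qA]] := IH (a :: L).
    by move=> l u; rewrite inE => /predU1P[->|/LU]; [exact: aU|exact].
  exists q; split=> // [l lL|]; first by apply: Lq; rewrite inE lL orbT.
  by rewrite inE (gt_eqF (Lq _ (mem_head _ _))).
rewrite -leNgt => ua; have [q [Lq qU qA]] := IH L LU.
by exists q; split=> //; rewrite inE (lt_eqF (lt_le_trans (qU u uU) ua)).
Qed.

(** * Embedding one enumeration into another *)

Definition order_embedding (f h : nat -> rat) (phi : nat -> nat) :=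
  {mono phi : i j / (i < j)%N} /\ forall i j, (h (phi i) < h (phi j)) = (f i < f j).

Lemma exists_order_embedding (f h : nat -> rat) :
  injective f -> bijective h -> exists phi, order_embedding f h phi.
Proof.
move=> finj [h' _ h'K].
pose good s := forall i j, (i < size s)%N -> (j < size s)%N ->
  ((nth 0 s i < nth 0 s j)%N = (i < j)%N) *
  ((h (nth 0 s i) < h (nth 0 s j)) = (f i < f j)).
(* Here [s] lists the first values of [phi]. A dummy value for bad [s] lets choice produce a total
   extension function. *)
have ext s : exists m, good s -> good (rcons s m).
  have [gs|ngs] := pselect (good s); last by exists 0%N.
  set n := size s.
  pose below := [seq h (nth 0 s i) | i <- iota 0 n & f i < f n].
  pose above := [seq h (nth 0 s i) | i <- iota 0 n & f n < f i].
  (* Avoiding these values forces the index of [q] beyond every entry of [s]. *)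
  pose early := [seq h k | k <- iota 0 (\max_(k <- s) k).+1].
  have [|q [belowq qabove qearly]] := @seq_between_notin _ early below above.
    move=> _ _ /mapP[i + ->] /mapP[j + ->].
    rewrite !mem_filter !mem_iota !add0n /= => /andP[fin ni] /andP[fnj nj].
    by rewrite gs// (lt_trans fin fnj).
  have sq i : (i < n)%N -> (nth 0 s i < h' q)%N.
    move=> ni; rewrite ltnNge; apply: contra qearly => le.
    apply/mapP; exists (h' q) => //; rewrite mem_iota/= add0n ltnS.
    apply: (leq_trans le).
    exact: (@leq_bigmax_seq _ s xpredT id _ (mem_nth 0 ni) isT).
  have fq i : (i < n)%N ->
      ((h (nth 0 s i) < q) = (f i < f n)) * ((q < h (nth 0 s i)) = (f n < f i)).
    move=> ni; have [lt|lt|/finj eq] := ltgtP (f i) (f n).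
    - have : h (nth 0 s i) < q.
        by apply/belowq/map_f; rewrite mem_filter lt mem_iota.
      by move=> lt'; split=> //; rewrite ltNge (ltW lt').
    - have : q < h (nth 0 s i).
        by apply/qabove/map_f; rewrite mem_filter lt mem_iota.
      by move=> lt'; split=> //; rewrite ltNge (ltW lt').
    - by rewrite eq ltnn in ni.
  exists (h' q) => _ i j; rewrite size_rcons !ltnS !nth_rcons -/n.
  rewrite (leq_eqVlt i) (leq_eqVlt j) => /predU1P[->|ni] /predU1P[->|nj];
    rewrite ?ltnn ?eqxx ?h'K.
  - by rewrite !ltxx.
  - by rewrite nj fq// ltnNge (ltnW (sq j nj)) ltnNge (ltnW nj).
  - by rewrite ni fq// sq.
  - by rewrite ni nj; exact: gs.
have [g gP] := choice ext.
pose P n := iter n (fun s => rcons s (g s)) [::].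
have sizeP n : size (P n) = n by elim: n => //= n IH; rewrite size_rcons IH.
have goodP n : good (P n) by elim: n => //= n; exact: gP.
have nthP n i : (i < n)%N -> nth 0 (P n) i = nth 0 (P i.+1) i.
  elim: n => // n IH; rewrite ltnS leq_eqVlt => /predU1P[->//|ni].
  by rewrite [P n.+1]/= nth_rcons sizeP ni IH.
(* [P i.+1] is the first prefix with an entry at [i]; two entries are compared inside a common
   prefix. *)
exists (fun i => nth 0 (P i.+1) i); split=> i j;
  rewrite -(@nthP (maxn i j).+1 i) ?ltnS ?leq_maxl//;
  rewrite -(@nthP (maxn i j).+1 j) ?ltnS ?leq_maxr//;
  by rewrite goodP ?sizeP ?ltnS ?leq_maxl ?leq_maxr.
Qed.

(** * The Cantor-Bernstein bijection *)

Lemma Cantor_Bernstein_fun (T U : Type) (phi : T -> U) (psi : U -> T) :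
  injective phi -> injective psi ->
  exists2 rho : T -> U, bijective rho & forall x, rho x = phi x \/ psi (rho x) = x.
Proof.
move=> phiI psiI.
(* [D] holds the points whose backward orbit stops outside the range of [psi]; [rho] is [phi] on [D]
   and inverts [psi] off [D]. *)
pose D := [set x | exists k y, ~ range psi y /\ x = iter k (psi \o phi) y].
have offD x : exists y, ~ D x -> psi y = x.
  have [[y _ yx]|nx] := pselect (range psi x); first by exists y.
  by exists (phi x) => -[]; exists 0%N, x.
have [psi' psi'K] := choice offD.
pose rho x := if x \in D then phi x else psi' x.
(* This invariance keeps the images of [D] and of its complement disjoint. *)
have DP x : D (psi (phi x)) <-> D x.
  split=> [[[|k] [y [ny]]]|[k [y [ny ->]]]]; last by exists k.+1, y.
    by move=> yE; case: ny; exists (phi x).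
  by move=> /psiI/phiI->; exists k, y.
have rhoD x : D x -> rho x = phi x by move=> Dx; rewrite /rho mem_set.
have rhoN x : ~ D x -> psi (rho x) = x.
  by move=> Dx; rewrite /rho memNset//; exact: psi'K.
exists rho; last first.
  by move=> x; have [/rhoD|/rhoN] := pselect (D x); [left|right].
rewrite -setTT_bijective; split=> // [x y _ _|y _].
  have [Dx|Dx] := pselect (D x); have [Dy|Dy] := pselect (D y).
  - by rewrite !rhoD// => /phiI.
  - by rewrite rhoD// => xy; case: (Dy); rewrite -(rhoN _ Dy) -xy DP.
  - by rewrite (rhoD y)// => xy; case: (Dx); rewrite -(rhoN _ Dx) xy DP.
  - by move=> xy; rewrite -(rhoN _ Dx) xy rhoN.
(* If [psi y] is in [D], it is at least one step along its orbit, and cancelling [psi] shows [y] as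
   the [phi]-image of the preceding orbit point. *)
have [Dy|Dy] := pselect (D (psi y)); last by exists (psi y) => //; apply/psiI/rhoN.
have [[|k] [z [nz]]] := Dy; first by move=> yz; case: nz; exists y.
move=> /psiI ->; exists (iter k (psi \o phi) z) => //.
by apply: rhoD; exists k, z.
Qed.

(** * Norms and tails under reindexing *)

Section NormReindex.
Context (R : realType).
Implicit Types (f h : nat -> rat) (x y : nat -> R) (phi psi rho sigma : nat -> nat).
Local Notation tail x n := (x \* \1_[set k | (n <= k)%N])%R.

Lemma ler_sier_norm f x y :
  (forall i, `|x i| <= `|y i|) -> (sier_norm f x <= sier_norm f y)%E.
Proof.
move=> xy; apply: sier_norm_le => F CF; apply: le_trans (sier_norm_ub y CF).
by rewrite lee_fin ler_sum.
Qed.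

Lemma sum_le_sier_norm h rho sigma x (F : {fset nat}) :
  cancel rho sigma ->
  {in F &, forall i j, (rho i < rho j)%N -> h (rho i) < h (rho j)} ->
  ((\sum_(i <- F) `|x i|)%:E <= sier_norm h (x \o sigma))%E.
Proof.
move=> rhoK hF; set G := (rho @` F)%fset.
have -> : \sum_(i <- F) `|x i| = \sum_(j <- G) `|(x \o sigma) j|.
  rewrite big_imfset/=; last by move=> i j _ _ /(can_inj rhoK).
  by apply: eq_bigr => i _; rewrite rhoK.
by apply: sier_norm_ub => _ _ /imfsetP[i iF ->] /imfsetP[j jF ->]; exact: hF.
Qed.

(* A chain splits into the part where [rho] is the embedding [phi] and the
   part where it inverts the embedding [psi]; [rho] sends each to a chain. *)
Lemma sier_norm_reindex f h phi psi rho sigma x :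
  order_embedding f h phi -> order_embedding h f psi ->
  cancel rho sigma -> (forall n, rho n = phi n \/ psi (rho n) = n) ->
  (sier_norm f x <= 2%:E * sier_norm h (x \o sigma))%E.
Proof.
move=> [phi_mono phi_emb] [psi_mono psi_emb] rhoK rhoP.
apply: sier_norm_le => F CF.
rewrite (bigID (fun i => rho i == phi i))/= EFinD mule_natl mule2n.
apply: leeD; rewrite big_fset_condE/=; apply: (sum_le_sier_norm _ rhoK) => i j.
- rewrite !inE/= => /andP[iF /eqP->] /andP[jF /eqP->].
  by rewrite phi_mono phi_emb; exact: CF.
- rewrite !inE/= => /andP[iF /eqP ri] /andP[jF /eqP rj].
  have [//|ei] := rhoP i; have [//|ej] := rhoP j.
  by rewrite -psi_mono -psi_emb ei ej; exact: CF.
Qed.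

(** Tail norms decrease with [n], so a single small one bounds all later ones and makes them
    finite. *)
Lemma in_sier_epsP f x : x \in in_sier f <-> forall e, 0 < e -> exists n,
  (sier_norm f (tail x n) <= e%:E)%E.
Proof.
set u := fun n => sier_norm f (tail x n).
split=> [/in_sierP ux e e0|H].
  have /fine_cvgP[ufin /cvgrPdist_le uE] := ux.
  have [n _ H] := filterI ufin (uE e e0).
  exists n; have [/fineK <-] := H n (leqnn n); rewrite lee_fin sub0r normrN.
  exact/le_trans/ler_norm.
have ule m n e : (n <= m)%N -> (u n <= e%:E)%E -> (u m <= e%:E)%E.
  move=> nm; apply: le_trans; apply: ler_sier_norm => i /=.
  rewrite !indicE !normrM ler_wpM2l// !normr_nat ler_nat.
  case: (boolP (i \in [set k | (m <= k)%N])) => //; rewrite inE/= => mi.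
  by rewrite mem_set//= (leq_trans nm mi).
have ufin n e : (u n <= e%:E)%E -> u n \is a fin_num.
  by move=> ue; rewrite ge0_fin_numE ?sier_norm_ge0// (le_lt_trans ue)// ltry.
apply/in_sierP/fine_cvgP; split.
  have [n un] := H 1 ltr01; exists n => // m nm.
  by apply: (ufin _ 1); exact: ule un.
apply/cvgrPdist_le => e e0; have [n un] := H e e0; exists n => // m nm.
rewrite sub0r normrN ger0_norm/= ?fine_ge0 ?sier_norm_ge0//.
by have um := ule _ _ _ nm un; rewrite -lee_fin fineK// (ufin _ e).
Qed.

Lemma in_sier_reindex f h (C : R) rho sigma x :
  cancel sigma rho -> 0 < C ->
  (forall y, (sier_norm h (y \o sigma) <= C%:E * sier_norm f y)%E) ->
  x \in in_sier f -> x \o sigma \in in_sier h.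
Proof.
move=> sigmaK C0 Cle /in_sier_epsP xf; apply/in_sier_epsP => e e0.
have [m xm] := xf _ (divr_gt0 e0 C0).
(* From this index on, [sigma k >= m], since [k = rho (sigma k)] exceeds every [rho j] with
   [j < m]. *)
exists (\max_(j < m) rho j).+1.
apply: (@le_trans _ _ (sier_norm h (tail x m \o sigma))).
  apply: ler_sier_norm => k /=; rewrite !indicE !normrM ler_wpM2l// !normr_nat ler_nat.
  case: (boolP (k \in _)) => //; rewrite inE/= => rk.
  rewrite mem_set//= leqNgt; apply/negP => skm.
  have := leq_bigmax (F := fun j : 'I_m => rho j) (Ordinal skm).
  by rewrite /= sigmaK leqNgt rk.
apply: (le_trans (Cle _)).
have -> : e%:E = (C%:E * (e / C)%:E)%E by rewrite -EFinM mulrC divfK ?gt_eqF.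
by rewrite lee_wpmul2l// lee_fin ltW.
Qed.

End NormReindex.

Section ReindexMap.
Context (R : realType) (f h : nat -> rat) (C : R) (rho sigma : nat -> nat).
Hypotheses (rhoK : cancel rho sigma) (sigmaK : cancel sigma rho) (C0 : 0 < C).
Hypothesis Cle : forall y : nat -> R,
  (sier_norm h (y \o sigma) <= C%:E * sier_norm f y)%E.

(** The parameters are kept abstract so that exchanging [f] with [h] and [rho] with [sigma] gives
    the inverse map. *)
Definition sier_reindex (x : sierpinski R f) : sierpinski R h :=
  Sierpinski (in_sier_reindex sigmaK C0 Cle (sier_valP x)).

Lemma sier_reindex_is_linear : linear sier_reindex.
Proof. by move=> a x y; exact/val_inj. Qed.

HB.instance Definition _ := GRing.isLinear.Build R (sierpinski R f)
  (sierpinski R h) _ sier_reindex sier_reindex_is_linear.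

Lemma sier_reindex_norm x : `|sier_reindex x| <= C * `|x|.
Proof.
rewrite -lee_fin EFinM !sierpinski_normE.
by rewrite !fineK ?sier_norm_fin_num ?sier_valP// Cle.
Qed.

Lemma sier_reindex_continuous : continuous sier_reindex.
Proof.
apply/linear_bounded_continuous/linear_boundedP; near=> r => x.
by rewrite (le_trans (sier_reindex_norm x))// ler_wpM2r//.
Unshelve. all: by end_near. Qed.

Lemma sier_reindex_basis n :
  sier_reindex (sier_basis R f n) = sier_basis R h (rho n).
Proof.
apply/val_inj/funext => k /=; rewrite !indicE !classical_sets.in_set1.
by congr (nat_of_bool _)%:R; apply/eqP/eqP => [<-|->].
Qed.

Lemma sier_reindex_fsum (c : nat -> R) : finite_set [set n | c n != 0] ->
  sier_reindex (\sum_(n \in [set n | c n != 0]) c n *: sier_basis R f n) =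
  \sum_(n \in [set n | c n != 0]) c n *: sier_basis R h (rho n).
Proof.
move=> fc; rewrite !fsbig_finite// raddf_sum; apply: eq_bigr => n _.
by rewrite -sier_reindex_basis; exact/val_inj.
Qed.

End ReindexMap.

Theorem theorem5p3 (R : realType) (f h : nat -> rat)
    (hf : bijective f) (hh : bijective h) :
  permutatively_equivalent (@sier_basis R f) (@sier_basis R h) /\
  linearly_homeomorphic (sierpinski R f) (sierpinski R h).
Proof.
have [phi phiE] := exists_order_embedding (bij_inj hf) hh.
have [psi psiE] := exists_order_embedding (bij_inj hh) hf.
have embI (a b : nat -> rat) g : order_embedding a b g -> injective g.
  move=> [mono _] i j gij; have := mono i j; have := mono j i.
  by rewrite gij ltnn; case: ltngtP.
have [rho [sigma rhoK sigmaK] rhoP] :=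
  Cantor_Bernstein_fun (embI _ _ _ phiE) (embI _ _ _ psiE).
(* The alternative for [rho] at [sigma n] is the same alternative for [sigma] with [phi] and [psi]
   exchanged. *)
have sigmaP n : sigma n = psi n \/ phi (sigma n) = n.
  by have [<-|] := rhoP (sigma n); rewrite sigmaK; [right|left].
have le_h (y : nat -> R) : (sier_norm h (y \o sigma) <= 2%:E * sier_norm f y)%E.
  have := sier_norm_reindex (y \o sigma) psiE phiE sigmaK sigmaP.
  by rewrite (_ : _ \o rho = y)//; apply/funext => k /=; rewrite rhoK.
have le_f (y : nat -> R) : (sier_norm f (y \o rho) <= 2%:E * sier_norm h y)%E.
  have := sier_norm_reindex (y \o rho) phiE psiE rhoK rhoP.
  by rewrite (_ : _ \o sigma = y)//; apply/funext => k /=; rewrite sigmaK.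
have two0 : (0 : R) < 2 by [].
pose T := sier_reindex sigmaK two0 le_h.
pose S := sier_reindex rhoK two0 le_f.
have TK : cancel T S by move=> x; apply/val_inj/funext => k /=; rewrite rhoK.
have SK : cancel S T by move=> x; apply/val_inj/funext => k /=; rewrite sigmaK.
split; last first.
  by exists T, S; split=> //; exact: sier_reindex_continuous.
exists rho, 2; split=> //; first by exists sigma.
  by rewrite ler1n.
move=> c fc; rewrite -(sier_reindex_fsum rhoK sigmaK two0 le_h fc) -/T.
set x := \sum_(n \in _) _.
(* The two bounds are the norm bound 2 for [T] at [x] and for [S] at [T x]. *)
rewrite ler_pdivrMl// sier_reindex_norm/=.
by rewrite -{1}(TK x) sier_reindex_norm.
Qed.
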